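(* Let $\mathbf{k}$ be an algebraically closed field of characteristic zero. Then every finite-dimensional Lie algebra over $\mathbf{k}$ can be completely disassembled (i.e. assembled in finitely many steps from dyons and triadons).
   Context: Two Lie algebra structures (Lie brackets) $[\cdot,\cdot]_1,[\cdot,\cdot]_2$ on the same vector space $V$ are compatible if $[\cdot,\cdot]_1+[\cdot,\cdot]_2$ is again a Lie bracket on $V$; their sum is the Lie algebra structure with this bracket. An $n$-dyon ($n\ge 2$) is a Lie algebra structure on an $n$-dimensional vector space isomorphic to the direct sum of the non-abelian $2$-dimensional Lie algebra $\langle e_1,e_2\mid [e_1,e_2]=e_2\rangle$ and the $(n-2)$-dimensional abelian Lie algebra. An $n$-triadon ($n\ge 3$) is a Lie algebra structure isomorphic to the direct sum of the $3$-dimensional Heisenberg algebra $\langle \varepsilon_1,\varepsilon_2,\varepsilon_3\mid [\varepsilon_1,\varepsilon_2]=\varepsilon_3,\ [\varepsilon_1,\varepsilon_3]=[\varepsilon_2,\varepsilon_3]=0\rangle$ and the $(n-3)$-dimensional abelian Lie algebra. Dyons and triadons are called lieons. A disassembling of a Lie algebra structure $\mathfrak g$ on $V$ is a finite rooted tree in which every non-leaf vertex has at least two children, together with an assignment $v\mapsto\mathfrak g_v$ of a Lie algebra structure on $V$ to every vertex, such that the root is assigned $\mathfrak g$ and, for every non-leaf vertex $v$ with children $v_1,\dots,v_p$, the structures $\mathfrak g_{v_1},\dots,\mathfrak g_{v_p}$ are mutually (pairwise) compatible and $\mathfrak g_v=\mathfrak g_{v_1}+\dots+\mathfrak g_{v_p}$.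 The disassembling is complete if all leaves are assigned lieons. The abelian (zero) structure is regarded as the empty sum of lieons (a convention that matters only in dimension at most $1$). *)

(* Defs.v *)
From mathcomp Require Import all_boot all_order all_algebra.

Set Implicit Arguments.
Unset Strict Implicit.
Unset Printing Implicit Defensive.

Import GRing.Theory.
Local Open Scope ring_scope.

Definition lie_bracket (k : fieldType) (V : lmodType k) (g : V -> V -> V) :
    Prop :=
  [/\ bilinear_for *:%R *:%R g,
      forall x, g x x = 0
    & forall x y z, g x (g y z) + g y (g z x) + g z (g x y) = 0].

Definition compatible (k : fieldType) (V : lmodType k) (g h : V -> V -> V) :
    Prop :=
  lie_bracket (fun x y => g x y + h x y).

Definition lie_isomorphic (k : fieldType) (V W : lmodType k)
    (g : V -> V -> V) (h : W -> W -> W) : Prop :=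
  exists f : {linear V -> W},
    bijective f /\ forall x y, f (g x y) = h (f x) (f y).

Definition direct_sum_bracket (k : fieldType) (V W : lmodType k)
    (g : V -> V -> V) (h : W -> W -> W) (u v : V * W) : V * W :=
  (g u.1 v.1, h u.2 v.2).

Definition abelian_bracket (k : fieldType) (V : lmodType k) (x y : V) : V := 0.

(* The alternating bilinear extensions of [e_1, e_2] = e_2 and of
   [eps_1, eps_2] = eps_3, [eps_1, eps_3] = [eps_2, eps_3] = 0 in the standard
   basis, which is numbered from 0. *)
Definition nonabelian2_bracket (k : fieldType) (x y : 'rV[k]_2) : 'rV[k]_2 :=
  (x 0 0 * y 0 1 - x 0 1 * y 0 0) *: delta_mx 0 1.

Definition heisenberg_bracket (k : fieldType) (x y : 'rV[k]_3) : 'rV[k]_3 :=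
  (x 0 0 * y 0 1 - x 0 1 * y 0 0) *: delta_mx 0 ord_max.

Lemma nonabelian2_bracket_basis (k : fieldType) :
  nonabelian2_bracket (delta_mx 0 0) (delta_mx 0 1) = delta_mx 0 1 :> 'rV[k]_2.
Proof. by rewrite /nonabelian2_bracket !mxE /= mulr0 subr0 mulr1 scale1r. Qed.

Lemma heisenberg_bracket_basis (k : fieldType)
    (e := delta_mx 0 : 'I_3 -> 'rV[k]_3) :
  [/\ heisenberg_bracket (e 0) (e 1) = e ord_max,
      heisenberg_bracket (e 0) (e ord_max) = 0
    & heisenberg_bracket (e 1) (e ord_max) = 0].
Proof.
by rewrite /heisenberg_bracket !mxE /= !mulr0 subr0 mulr1 subrr scale1r scale0r.
Qed.

Definition dyon (k : fieldType) (V : vectType k) (g : V -> V -> V) : Prop :=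
  let n := \dim {:V} in
  (2 <= n)%N /\
  lie_isomorphic g
    (direct_sum_bracket (@nonabelian2_bracket k)
                        (@abelian_bracket k 'rV[k]_(n - 2))).

Definition triadon (k : fieldType) (V : vectType k) (g : V -> V -> V) : Prop :=
  let n := \dim {:V} in
  (3 <= n)%N /\
  lie_isomorphic g
    (direct_sum_bracket (@heisenberg_bracket k)
                        (@abelian_bracket k 'rV[k]_(n - 3))).

Definition lieon (k : fieldType) (V : vectType k) (g : V -> V -> V) : Prop :=
  dyon g \/ triadon g.

(* Finite rooted trees whose vertices are labelled by elements of L; the
   subtrees rooted at the children of a vertex are indexed by 'I_p. *)
Inductive labelled_tree (L : Type) : Type :=
| Leaf of L
| Node (a : L) (p : nat) (c : 'I_p -> labelled_tree L).

Arguments Node {L} a p c.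

Definition label (L : Type) (t : labelled_tree L) : L :=
  match t with Leaf a => a | Node a _ _ => a end.

Fixpoint well_assembled (k : fieldType) (V : vectType k)
    (t : labelled_tree (V -> V -> V)) : Prop :=
  match t with
  | Leaf g => lie_bracket g
  | Node g p c =>
      [/\ lie_bracket g,
          (2 <= p)%N,
          forall i j : 'I_p, i != j -> compatible (label (c i)) (label (c j)),
          forall x y, g x y = \sum_(i < p) label (c i) x y
        & forall i, well_assembled (c i)]
  end.

Fixpoint all_leaves (L : Type) (P : L -> Prop) (t : labelled_tree L) : Prop :=
  match t with
  | Leaf a => P a
  | Node _ p c => forall i : 'I_p, all_leaves P (c i)
  end.

Definition disassembling (k : fieldType) (V : vectType k) (g : V -> V -> V)
    (t : labelled_tree (V -> V -> V)) : Prop :=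
  label t =2 g /\ well_assembled t.

Definition complete_disassembling (k : fieldType) (V : vectType k)
    (g : V -> V -> V) (t : labelled_tree (V -> V -> V)) : Prop :=
  disassembling g t /\ all_leaves (@lieon k V) t.

(* There are no lieons in dimension at most 1; there the zero structure counts
   as the empty sum of lieons. From dimension 2 on, a tree is required even for
   the zero structure. *)
Definition completely_disassemblable (k : fieldType) (V : vectType k)
    (g : V -> V -> V) : Prop :=
  ((\dim {:V} <= 1)%N /\ forall x y, g x y = 0) \/
  exists t, complete_disassembling g t.

(* Main.v *)
Require Import Defs.
From mathcomp Require Import all_boot all_order all_algebra.
From HB Require Import structures.
From mathcomp Require Import ring zify.
From Stdlib Require Import Classical.

(** Two brackets whose sum is a Lie bracket are compatible by definition, so
    binary vertices come for free: as soon as a Lie bracket is a sum of two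
    brackets that can be assembled from lieons, so is it ([assemblableD]).
    Three ideas then suffice.

    Two contractions. Suppose that V is the direct sum, as a vector space, of
    two subalgebras S and T. The contraction of g along S keeps the bracket of
    S and its action on V / S, here realised on T, and makes T abelian; it is
    a Lie bracket because S is a subalgebra ([contraction_lie]). The components
    of g are S S -> S, T T -> T and the two halves S T -> T and S T -> S of the
    mixed bracket, so g is the sum of its contractions along S and along T
    ([contractionD]).

    Induction. The claim proved by induction on dim A is that a semidirect
    product A |x M of a subalgebra A and an abelian ideal M with A + M = V can
    be assembled ([semidirect_assemblable]); A = V and M = 0 gives the theorem.
    If A = S + T with S and T proper complementary subalgebras, the two
    contractions along S + M and T are again semidirect products
    S |x (T + M) and T |x (S + M), with a smaller first factor. If dim A <= 1,
    the bracket amounts to a single linear operator on M, and splitting that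
    operator into operators of rank one writes g as a sum of brackets
    (a /\ f) v with a v = 0. Each of them is zero, a dyon (f v <> 0) or a
    triadon (f v = 0), and partial sums are Lie brackets because only one
    operator acts ([wedge_lieon], [line_action_assemblable]).

    Complementary subalgebras. It remains to split every Lie algebra A of
    dimension at least 2 ([subalgebra_splits]). If some ad x is not nilpotent
    on A, the generalised eigenspaces of ad x grade A by the roots. Since the
    characteristic is zero, there is an integral weight on the finitely many
    roots which is additive whenever a sum of roots is a root, and which is
    positive on a chosen nonzero root ([additive_weight]). The parts of weight
    <= 0 and > 0 are complementary subalgebras; x lies in the first, and the
    second contains an eigenvector. If every ad x is nilpotent on A, Engel's
    argument provides a subalgebra of codimension one, and any line outside it
    is a complementary subalgebra ([nilpotent_splits]). *)

Set Implicit Arguments.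
Unset Strict Implicit.
Unset Printing Implicit Defensive.

Import Order.TTheory GRing.Theory Num.Theory.
Local Open Scope ring_scope.

(** * Lie brackets *)

Section LieBrackets.
Variables (k : fieldType) (V : lmodType k).
Implicit Types (g h : V -> V -> V) (x y z : V).

Section Laws.
Variables (g : V -> V -> V) (hg : lie_bracket g).

Lemma lie_linear x : linear (g x).
Proof. by case: hg => -[_ hr] _ _; apply: hr. Qed.

Lemma lie_xx x : g x x = 0.
Proof. by case: hg => _ h _; apply: h. Qed.

Lemma lie_jacobi x y z : g x (g y z) + g y (g z x) + g z (g x y) = 0.
Proof. by case: hg => _ _; apply. Qed.

Lemma lieDr x y z : g x (y + z) = g x y + g x z.
Proof. by have:= lie_linear x 1 y z; rewrite !scale1r. Qed.

Lemma lie0r x : g x 0 = 0.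
Proof. by apply: (addIr (g x 0)); rewrite -lieDr !add0r. Qed.

Lemma lieZr x a y : g x (a *: y) = a *: g x y.
Proof. by have:= lie_linear x a y 0; rewrite lie0r !addr0. Qed.

Lemma lieNr x y : g x (- y) = - g x y.
Proof. by rewrite -scaleN1r lieZr scaleN1r. Qed.

Lemma lieBr x y z : g x (y - z) = g x y - g x z.
Proof. by rewrite lieDr lieNr. Qed.

Lemma lieDl x y z : g (x + y) z = g x z + g y z.
Proof.
have [[hl _] _ _] := hg.
by have:= hl z 1 x y; rewrite /= !scale1r.
Qed.

Lemma lieC x y : g x y = - g y x.
Proof.
apply/eqP; rewrite -addr_eq0; apply/eqP.
by have:= lie_xx (x + y); rewrite lieDl !lieDr !lie_xx add0r addr0.
Qed.

Lemma lie0l x : g 0 x = 0.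
Proof. by rewrite lieC lie0r oppr0. Qed.

Lemma lieZl x a y : g (a *: x) y = a *: g x y.
Proof. by rewrite lieC lieZr -scalerN -lieC. Qed.

Lemma lieBl x y z : g (x - y) z = g x z - g y z.
Proof. by rewrite -(scaleN1r y) lieDl lieZl scaleN1r. Qed.

Lemma lie_leibniz x y z : g x (g y z) = g (g x y) z + g y (g x z).
Proof.
apply/eqP; rewrite -subr_eq0 -(lie_jacobi x y z) opprD addrA; apply/eqP.
by rewrite (lieC (g x y) z) opprK (lieC x z) lieNr opprK addrAC.
Qed.

End Laws.

Lemma lie_bracketI g :
    (forall x, linear (g x)) -> (forall x y, g x y = - g y x) ->
    (forall x, g x x = 0) ->
    (forall x y z, g x (g y z) + g y (g z x) + g z (g x y) = 0) ->
  lie_bracket g.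
Proof.
move=> glin gC gxx gJ; split=> //; split=> x; last exact: glin.
by move=> a u v; rewrite /= gC glin opprD -scalerN -!gC.
Qed.

Lemma eq_lie_bracket g h : g =2 h -> lie_bracket g -> lie_bracket h.
Proof.
move=> e hg; apply: lie_bracketI => [x a u v|x y|x|x y z].
- by rewrite -!e; apply: lie_linear.
- by rewrite -!e; apply: lieC.
- by rewrite -e; apply: lie_xx.
by rewrite -!e; apply: lie_jacobi.
Qed.

End LieBrackets.

(** * Assembling *)

Definition assemblable (k : fieldType) (V : vectType k) (g : V -> V -> V) :=
  exists t, complete_disassembling g t.

Section Assembling.
Variables (k : fieldType) (V : vectType k).
Implicit Types (g h : V -> V -> V) (x y z : V).

Lemma assemblable_lieon g : lie_bracket g -> lieon g -> assemblable g.
Proof. by move=> hg lg; exists (Leaf g). Qed.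

Lemma eq_assemblable g h : g =2 h -> assemblable g -> assemblable h.
Proof.
move=> e [t [[tl tw] ta]]; exists t; split=> //; split=> // x y.
by rewrite tl e.
Qed.

(** Compatibility of the two summands is what it means for their sum, here g,
    to be a Lie bracket. *)
Lemma assemblableD g g1 g2 : lie_bracket g ->
    (forall x y, g x y = g1 x y + g2 x y) ->
  assemblable g1 -> assemblable g2 -> assemblable g.
Proof.
move=> hg e [t1 [[l1 w1] a1]] [t2 [[l2 w2] a2]].
exists (Node g 2 (fun i : 'I_2 => if i == 0 then t1 else t2)).
have hs : lie_bracket (fun x y => label t1 x y + label t2 x y).
  by apply: eq_lie_bracket hg => x y; rewrite e l1 l2.
split; last by move=> i /=; case: (i == 0).
split=> //; split=> //.
- move=> i j nij; rewrite /compatible.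
  have [i0|i0] := eqVneq i 0; have [j0|j0] := eqVneq j 0 => //.
  + by move: nij; rewrite i0 j0 eqxx.
  + by apply: eq_lie_bracket hs => x y; rewrite addrC.
  by case: i j i0 j0 nij => [[|[|i]] //= ?] [[|[|j]] //= ?].
- by move=> x y; rewrite big_ord_recl big_ord1 /= l1 l2 e.
by move=> i; case: (i == 0).
Qed.

End Assembling.

(** * Dyons and triadons *)

(** A partial dual basis l, w extends to an isomorphism of V with a direct sum
    whose first coordinates are the l i. The second component must vanish on the
    w j, so it is read off from x minus its combination of the w j, which lies
    in the common kernel of the l i. This is the shape of the isomorphisms asked
    for in the definitions of dyons and triadons. *)
Lemma adapted_coordinates (k : fieldType) (V : vectType k) (m : nat)
    (l : 'I_m -> 'Hom(V, k^o)) (w : 'I_m -> V) :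
    (forall i j, l i (w j) = (i == j)%:R) ->
  (m <= \dim {:V})%N /\
  exists f : {linear V -> ('rV[k]_m * 'rV[k]_(\dim {:V} - m))%type},
    [/\ bijective f, forall x i, (f x).1 0 i = l i x
      & forall j, f (w j) = (delta_mx 0 j, 0)].
Proof.
move=> lw; set n := \dim {:V}.
have L_lin : linear (fun x => \row_i (l i x : k)).
  by move=> a x y; apply/rowP=> i; rewrite !mxE linearP.
pose L := linfun (HB.pack (fun x => \row_i (l i x : k))
  (GRing.isLinear.Build _ _ _ _ _ L_lin) : {linear V -> 'rV[k]_m}).
have LE x i : L x 0 i = l i x by rewrite lfunE mxE.
have Lw j : L (w j) = delta_mx 0 j.
  by apply/rowP=> i; rewrite LE lw !mxE eqxx.
pose K := lker L.
have Lf : limg L = fullv.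
  apply/eqP; rewrite eqEsubv subvf; apply/subvP => u _.
  rewrite (row_sum_delta u) memv_suml // => j _.
  by rewrite memvZ // -Lw memv_img ?memvf.
have dimK : (\dim K + m = n)%N.
  have:= limg_ker_dim L {:V}; rewrite capfv Lf [X in (_ + X)%N]dimvf dim_matrix.
  by rewrite mul1r.
have [X bX] : exists X : (n - m).-tuple V, basis_of K X.
  by rewrite -dimK addnK; exists (vbasis K); apply: vbasisP.
split; first by rewrite -dimK leq_addl.
(* s is the section of L determined by w, so x - s (L x) lies in K. *)
pose s (u : 'rV[k]_m) := \sum_i u 0 i *: w i.
have s_lin : linear s.
  move=> a u v; rewrite /s scaler_sumr -big_split; apply: eq_bigr => i _ /=.
  by rewrite !mxE scalerDl scalerA.
have Ls u : L (s u) = u.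
  rewrite linear_sum [RHS]row_sum_delta; apply: eq_bigr => i _.
  by rewrite linearZ /= Lw.
have sK x : x - s (L x) \in K by rewrite memv_ker linearB /= Ls subrr.
pose r x : 'rV[k]_(n - m) := \row_j coord X j (x - s (L x)).
have f_lin : linear (fun x => (L x, r x) : ('rV[k]_m * 'rV[k]_(n - m))%type).
  move=> a x y; rewrite /r linearP s_lin; congr pair; apply/rowP=> j.
  by rewrite !mxE opprD addrACA -scalerBr linearP.
pose f : {linear V -> _} := HB.pack (fun x => (L x, r x))
  (GRing.isLinear.Build _ _ _ _ _ f_lin).
exists f; split=> // [|j]; last first.
  congr pair; first exact: Lw.
  have sw : s (L (w j)) = w j.
    rewrite Lw /s (bigD1 j) //= big1 ?addr0 ?mxE ?eqxx ?scale1r // => i /negPf ne.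
    by rewrite mxE ne andbF scale0r.
  by apply/rowP=> i; rewrite !mxE sw subrr linear0.
exists (fun p : 'rV[k]_m * 'rV[k]_(n - m) =>
          s p.1 + \sum_j p.2 0 j *: X`_j) => [x|[u v]] /=.
  under eq_bigr => j _ do rewrite mxE.
  by rewrite -(coord_basis bX (sK x)) addrC subrK.
have XK : \sum_j v 0 j *: X`_j \in K.
  apply: memv_suml => j _; rewrite memvZ // (basis_mem bX) // mem_nth //.
  by rewrite size_tuple.
have e : L (s u + \sum_j v 0 j *: X`_j) = u.
  by move: XK; rewrite memv_ker linearD /= Ls => /eqP ->; rewrite addr0.
rewrite /r e; congr pair; apply/rowP => j; rewrite mxE addrC addKr.
by rewrite coord_sum_free // (basis_free bX).
Qed.

Section ElementaryBrackets.
Variables (k : fieldType) (V : vectType k).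
Implicit Types (a f c : 'Hom(V, k^o)) (v x y z : V).

(** The bracket (a /\ f) v. *)
Definition wedge_bracket a f v x y : V := (a x * f y - a y * f x) *: v.

(** As a v = 0, the functional a vanishes on every bracket, so the iterated
    bracket of x, y, z is a x (a y f z - a z f y) (f v) times v, and the cyclic
    sum of these coefficients vanishes. *)
Lemma wedge_lie a f v : a v = 0 -> lie_bracket (wedge_bracket a f v).
Proof.
rewrite /wedge_bracket => av; apply: lie_bracketI => [x b y z|x y|x|x y z].
- rewrite scalerA -scalerDl !linearP /=; congr (_ *: _).
  by rewrite /GRing.scale /=; ring.
- by rewrite -[RHS]scaleNr opprB.
- by rewrite subrr scale0r.
rewrite !linearZ /= av !scaler0 -!scalerDl /GRing.scale /=.
by rewrite -[RHS](scale0r v); congr (_ *: _); ring.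
Qed.


Fact coord_linear n (X : n.-tuple V) i : linear (coord X i : V -> k^o).
Proof. by move=> b x y; rewrite linearP. Qed.

Definition coordinate n (X : n.-tuple V) i : 'Hom(V, k^o) :=
  linfun (HB.pack (coord X i : V -> k^o)
    (GRing.isLinear.Build k V k^o _ _ (coord_linear X i)) : {linear V -> k^o}).

Lemma coordinateE n (X : n.-tuple V) i v : coordinate X i v = coord X i v.
Proof. by rewrite lfunE. Qed.

Lemma functionalZ f b v : f (b *: v) = b * f v :> k.
Proof. by rewrite linearZ. Qed.

Lemma scale_functionalE b f v : (b *: f) v = b * f v :> k.
Proof. by rewrite scale_lfunE. Qed.

(** Cramer's rule for the pair (a, f), whose restriction to x0, y0 is
    invertible. *)
Lemma wedge_dual_vectors a f x0 y0 : a x0 * f y0 - a y0 * f x0 != 0 ->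
  exists e1 e2, [/\ a e1 = 1, f e1 = 0, a e2 = 0 & f e2 = 1].
Proof.
pose d : k := a x0 * f y0 - a y0 * f x0; rewrite -[X in X != 0]/d => d0.
exists (d^-1 *: (f y0 *: x0 - f x0 *: y0)), (d^-1 *: (a x0 *: y0 - a y0 *: x0)).
have E (l : 'Hom(V, k^o)) (p q : k) u w :
    l (d^-1 *: (p *: u - q *: w)) = d^-1 * (p * l u - q * l w) :> k.
  by rewrite functionalZ linearB /= !functionalZ.
rewrite !{}E.
split; [|by ring|by ring|];
  by rewrite -[RHS](mulVf d0) /d; congr (_ * _); ring.
Qed.

(** Replacing a by (f v) a and f by f / f v leaves a /\ f unchanged and makes
    v dual to the second functional: v plays the role of e_2. *)
Lemma wedge_dyon a f v x0 y0 : a v = 0 -> f v != 0 ->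
  a x0 * f y0 - a y0 * f x0 != 0 -> dyon (wedge_bracket a f v).
Proof.
move=> av fv /wedge_dual_vectors [e1 [e2 [ae1 fe1 ae2 fe2]]].
pose l (i : 'I_2) := if i == 0 then f v *: a else (f v)^-1 *: f.
pose w (i : 'I_2) := if i == 0 then (f v)^-1 *: e1 else v.
have [|n2 [h [hb hl hw]]] := @adapted_coordinates k V 2 l w.
  move=> [[|[|?]] //= ?] [[|[|?]] //= ?];
    rewrite /l /w /= scale_functionalE ?functionalZ.
  - by rewrite ae1 mulr1 mulfV.
  - by rewrite av mulr0.
  - by rewrite fe1 !mulr0.
  - by rewrite mulVf.
split=> //; exists h; split=> // x y.
have -> : wedge_bracket a f v x y = (l 0 x * l 1 y - l 0 y * l 1 x) *: w 1.
  congr (_ *: _); rewrite !scale_functionalE.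
  have cancel_scale (c p q r s : k) : c != 0 ->
      p * q - r * s = c * p * (c^-1 * q) - c * r * (c^-1 * s).
    by move=> c0; field.
  exact: cancel_scale.
rewrite linearZ /= hw /direct_sum_bracket /nonabelian2_bracket !hl.
by congr pair; rewrite /= ?scaler0 // [l 1 x * _]mulrC.
Qed.

(** Here v is killed by both a and f, so a third functional c with c v = 1 is
    needed to complete the dual basis; e1 and e2 are moved into its kernel. *)
Lemma wedge_triadon a f v x0 y0 : a v = 0 -> f v = 0 -> v != 0 ->
  a x0 * f y0 - a y0 * f x0 != 0 -> triadon (wedge_bracket a f v).
Proof.
move=> av fv v0 /wedge_dual_vectors [e1 [e2 [ae1 fe1 ae2 fe2]]].
have [c cv] : exists c : 'Hom(V, k^o), c v = 1.
  exists (coordinate [tuple v] 0); rewrite coordinateE.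
  have := @coord_free k V 1 [tuple v] 0 0; rewrite /= => -> //.
  by rewrite seq1_free.
pose l (i : 'I_3) := if i == 0 then a else if i == 1 then f else c.
pose w (i : 'I_3) := if i == 0 then e1 - c e1 *: v else
  if i == 1 then e2 - c e2 *: v else v.
have [|n3 [h [hb hl hw]]] := @adapted_coordinates k V 3 l w.
  move=> [[|[|[|?]]] //= ?] [[|[|[|?]]] //= ?]; rewrite /l /w /=;
  by rewrite ?linearB /= ?functionalZ ?av ?fv ?cv ?ae1 ?ae2 ?fe1 ?fe2
    ?mulr0 ?mulr1 ?subr0 ?subrr.
split=> //; exists h; split=> // x y.
rewrite linearZ (hw ord_max : h v = _).
rewrite /direct_sum_bracket /heisenberg_bracket !hl.
by congr pair; rewrite /= ?scaler0 // [f x * _]mulrC.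
Qed.

Lemma wedge_lieon a f v x0 y0 :
  a v = 0 -> wedge_bracket a f v x0 y0 != 0 -> lieon (wedge_bracket a f v).
Proof.
rewrite scaler_eq0 negb_or => av /andP[d0 v0].
have [fv|fv] := eqVneq (f v) 0.
  by right; apply: wedge_triadon d0.
by left; apply: wedge_dyon d0.
Qed.

(** In dimension at least 2 there is a dyon d, and 0 = d + (- d). *)
Lemma zero_assemblable g : (1 < \dim {:V})%N -> (forall x y, g x y = 0) ->
  assemblable g.
Proof.
move=> n2 g0.
have [X bX] : exists X : (\dim {:V}).-tuple V, basis_of {:V} X.
  by exists (vbasis {:V}); apply: vbasisP.
pose i0 := Ordinal (ltnW n2); pose i1 := Ordinal n2.
have cX (i j : 'I__) : coordinate X i X`_j = (i == j)%:R.
  by rewrite coordinateE coord_free ?(basis_free bX) // eq_sym.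
pose d b := wedge_bracket (coordinate X i0) (coordinate X i1) (b *: X`_i1).
have av b : coordinate X i0 (b *: X`_i1) = 0.
  by rewrite functionalZ cX mulr0.
have dA b : b != 0 -> assemblable (d b).
  move=> b0; apply: assemblable_lieon; first exact: wedge_lie.
  apply: (@wedge_lieon _ _ _ X`_i0 X`_i1) => //.
  rewrite /wedge_bracket !cX /= !mulr0 mul1r subr0 scale1r scaler_eq0 negb_or b0.
  by apply: (basis_not0 bX); rewrite mem_nth // size_tuple.
apply: (@assemblableD _ _ _ (d 1) (d (- 1))).
- apply: lie_bracketI => [x b y z|x y|x|x y z]; rewrite !g0 //.
  + by rewrite scaler0 addr0.
  + by rewrite oppr0.
  + by rewrite !addr0.
- by move=> x y; rewrite g0 /d /wedge_bracket scale1r scaleN1r scalerN subrr.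
- by apply: dA; apply: oner_neq0.
- by apply: dA; rewrite oppr_eq0 oner_neq0.
Qed.

Lemma wedge_assemblable a f v :
  (1 < \dim {:V})%N -> a v = 0 -> assemblable (wedge_bracket a f v).
Proof.
move=> n2 av.
have [[x0 [y0 n0]]|z] := classic (exists x y, wedge_bracket a f v x y != 0).
  by apply: assemblable_lieon; [apply: wedge_lie | apply: wedge_lieon n0].
apply: zero_assemblable => // x y; apply/eqP/negPn/negP => n0.
by apply: z; exists x, y.
Qed.

End ElementaryBrackets.

Definition subalgebra (k : fieldType) (V : vectType k) (g : V -> V -> V)
    (A : {vspace V}) :=
  forall x y, x \in A -> y \in A -> g x y \in A.

(** * Contraction along a subalgebra *)

Section Contraction.
Variables (k : fieldType) (V : vectType k) (g : V -> V -> V).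
Variables (S T : {vspace V}).
Hypotheses (hg : lie_bracket g) (ST0 : (S :&: T = 0)%VS).
Hypothesis STf : (S + T = fullv)%VS.

Notation p := (daddv_pi S T).
Notation q := (daddv_pi T S).

(** The bracket of S x (V / S), where S acts on the abelian ideal V / S, with
    V / S identified with T. *)
Definition contraction (x y : V) : V :=
  g (p x) (p y) + q (g (p x) (q y) + g (q x) (p y)).

Let TS0 : (T :&: S = 0)%VS. Proof. by rewrite capvC. Qed.
Let pS x : p x \in S. Proof. exact: memv_pi. Qed.
Let qT x : q x \in T. Proof. exact: memv_pi. Qed.
Let pq x : p x + q x = x.
Proof. by rewrite daddv_pi_add // STf memvf. Qed.
Let p_id x : x \in S -> p x = x. Proof. exact: daddv_pi_id. Qed.
Let q_id x : x \in T -> q x = x. Proof. exact: daddv_pi_id. Qed.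
Let q_S x : x \in S -> q x = 0.
Proof. by move=> xS; apply: (addrI (p x)); rewrite pq addr0 p_id. Qed.
Let p_T x : x \in T -> p x = 0.
Proof. by move=> xT; apply: (addIr (q x)); rewrite pq add0r q_id. Qed.

Lemma contraction_in x y : x \in S -> y \in S -> contraction x y = g x y.
Proof.
move=> xS yS; rewrite /contraction (p_id xS) (p_id yS) (q_S xS) (q_S yS).
by rewrite (lie0l hg) (lie0r hg) addr0 linear0 addr0.
Qed.

Lemma contraction_mixed x y : x \in S -> y \in T -> contraction x y = q (g x y).
Proof.
move=> xS yT; rewrite /contraction (p_id xS) (q_id yT) (q_S xS) (p_T yT).
by rewrite !(lie0r hg) add0r addr0.
Qed.

Lemma contraction_out x y : x \in T -> y \in T -> contraction x y = 0.
Proof.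
move=> xT yT; rewrite /contraction (p_T xT) (p_T yT) !(lie0r hg) (lie0l hg).
by rewrite addr0 linear0 addr0.
Qed.

Hypothesis sS : subalgebra g S.

(** Under the outer q, the projection of the inner brackets to T can be dropped:
    what it discards is in S, and so is the bracket of that with p x. *)
Let contraction2 x y z : contraction x (contraction y z) =
  g (p x) (g (p y) (p z)) +
  q (g (p x) (g (p y) (q z)) + g (p x) (g (q y) (p z)) + g (q x) (g (p y) (p z))).
Proof.
set B := g (p y) (q z) + g (q y) (p z).
have yzS : g (p y) (p z) \in S by apply: sS.
have pc : p (contraction y z) = g (p y) (p z).
  by rewrite linearD /= (p_id yzS) (p_T (qT _)) addr0.
have qc : q (contraction y z) = q B.
  by rewrite linearD /= (q_S yzS) (q_id (qT _)) add0r.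
rewrite {1}/contraction pc qc -(lieDr hg) -/B; congr (_ + _).
clearbody B; rewrite [LHS]linearD [RHS]linearD /=; congr (_ + _).
rewrite -[in RHS](pq B) (lieDr hg) linearD /= [q (g _ (p B))]q_S ?add0r //.
exact: sS.
Qed.

(** By [contraction2] the Jacobi sum consists of the Jacobi identity of g on
    (p x, p y, p z) and the image under q of the three identities in which one
    of the arguments is taken in T. *)
Lemma contraction_lie : lie_bracket contraction.
Proof.
apply: lie_bracketI => [x a y z|x y|x|x y z].
- rewrite /contraction !linearP /= !(lie_linear hg).
  by rewrite [X in q X]addrACA -scalerDr linearP /= addrACA -scalerDr.
- rewrite /contraction opprD -linearN opprD -!(lieC hg).
  by rewrite [X in q X]addrC.
- by rewrite /contraction (lie_xx hg) (lieC hg (p x)) addNr linear0 addr0.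
rewrite !contraction2 [LHS](AC ((2*2)*2) ((1*3*5)*(2*4*6)))/= (lie_jacobi hg) add0r.
rewrite -!linearD -[RHS](linear0 q); congr (q _).
rewrite [LHS](AC (3*3*3) ((1*5*9)*(2*6*7)*(3*4*8)))/=.
by rewrite !(lie_jacobi hg) !addr0.
Qed.

End Contraction.

Lemma daddv_pi0 (k : fieldType) (V : vectType k) (S T : {vspace V}) x :
  (S :&: T = 0)%VS -> x \in T -> daddv_pi S T x = 0.
Proof.
move=> ST0 xT; have xS : x \in (S + T)%VS by apply: (subvP (addvSr S T)).
have := daddv_pi_add ST0 xS; rewrite [X in _ + X]daddv_pi_id 1?capvC //.
by move/(canRL (addrK _)); rewrite subrr.
Qed.

(** The mixed bracket has a component in T, kept by the contraction along S,
    and a component in S, kept by the other one. *)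
Lemma contractionD (k : fieldType) (V : vectType k) (g : V -> V -> V)
    (S T : {vspace V}) :
    lie_bracket g -> (S :&: T = 0)%VS -> (S + T = fullv)%VS ->
    forall x y, g x y = contraction g S T x y + contraction g T S x y.
Proof.
move=> hg ST0 STf x y.
have pq z : daddv_pi S T z + daddv_pi T S z = z by rewrite daddv_pi_add // STf memvf.
rewrite -{1}(pq x) -{1}(pq y) !(lieDl hg) !(lieDr hg) /contraction.
move: (daddv_pi S T) (daddv_pi T S) pq => p q pq.
rewrite [g (q x) (p y) + _ in RHS]addrC [RHS](AC (2*2) ((1*3)*(4*2)))/= pq.
by rewrite [LHS](AC (2*2) ((1*4)*(2*3))).
Qed.


(** * Products of shifts of a linear operator *)

Section RootOperators.
Variables (k : fieldType) (V : vectType k) (D : 'End(V)).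
Implicit Types (s t r : seq k) (u v w : V) (A : {vspace V}).

(** The product of the operators D - a for a in s. Lists of scalars stand for
    split polynomials in D: the kernel of [shift_prod s] is the sum of the
    generalised eigenspaces for the members of s, if each occurs often enough. *)
Definition shift_prod s : 'End(V) :=
  foldr (fun a F => ((D - a *: \1) \o F)%VF) \1%VF s.

Lemma shift_prod_nil w : shift_prod [::] w = w.
Proof. exact: id_lfunE. Qed.

Lemma shift_prod_cons a s w :
  shift_prod (a :: s) w = D (shift_prod s w) - a *: shift_prod s w.
Proof. by rewrite comp_lfunE add_lfunE opp_lfunE scale_lfunE id_lfunE. Qed.

Lemma lfun_shift (F : 'End(V)) u a w : F (u - a *: w) = F u - a *: F w.
Proof. by rewrite linearB linearZ. Qed.

Lemma shift_prodD s w : shift_prod s (D w) = D (shift_prod s w).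
Proof.
elim: s => [|a s IHs]; first by rewrite !shift_prod_nil.
by rewrite !shift_prod_cons IHs lfun_shift.
Qed.

Lemma shift_prod_consr a s w :
  shift_prod (a :: s) w = shift_prod s (D w - a *: w).
Proof. by rewrite shift_prod_cons lfun_shift shift_prodD. Qed.

Lemma shift_prod_cat s t w : shift_prod (s ++ t) w = shift_prod s (shift_prod t w).
Proof.
elim: s => [|a s IHs]; first by rewrite shift_prod_nil.
by rewrite /= !shift_prod_cons IHs.
Qed.

Lemma shift_prod_catr s t w : shift_prod (s ++ t) w = shift_prod t (shift_prod s w).
Proof.
elim: s w => [|a s IHs] w; first by rewrite shift_prod_nil.
by rewrite /= !shift_prod_consr IHs.
Qed.

Lemma shift_prod_eigen a s w :
  D w = a *: w -> shift_prod s w = (\prod_(b <- s) (a - b)) *: w.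
Proof.
move=> Dw; elim: s => [|b s IHs]; first by rewrite shift_prod_nil big_nil scale1r.
by rewrite shift_prod_cons IHs linearZ /= Dw !scalerA -scalerBl big_cons;
   congr (_ *: _); ring.
Qed.

Lemma shift_prod_eigen_eq0 a s w :
  D w = a *: w -> (shift_prod s w == 0) = (a \in s) || (w == 0).
Proof.
move=> Dw; rewrite (shift_prod_eigen _ Dw) scaler_eq0; congr (_ || _).
rewrite prodf_seq_eq0; apply/hasP/idP => [[b bs /= /eqP ab]|as_].
  by rewrite (subr0_eq ab).
by exists a; rewrite //= subrr.
Qed.

(** A polynomial is coprime to another one with disjoint roots; the proof
    strips off the factors of the first one by one. *)
Lemma shift_prod_disjoint s t w : (forall a, a \in s -> a \notin t) ->
  shift_prod s w = 0 -> shift_prod t w = 0 -> w = 0.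
Proof.
elim: s w => [|a s IHs] w st; first by rewrite shift_prod_nil.
rewrite shift_prod_consr => sw tw; apply/eqP.
have /eqP : D w - a *: w = 0.
  apply: IHs => //; first by move=> b bs; apply: st; rewrite inE bs orbT.
  by rewrite lfun_shift shift_prodD tw linear0 scaler0 subrr.
rewrite subr_eq0 => /eqP Dw; move/eqP: tw; rewrite (shift_prod_eigen_eq0 _ Dw).
by rewrite (negPf (st a _)) ?mem_head.
Qed.

Section Stable.
Variable A : {vspace V}.
Hypothesis DA : forall w, w \in A -> D w \in A.

(** D - a is invertible on the kernel of a product of factors D - b with b
    different from a, because there D - a = (D - b) + (b - a). *)
Lemma shift_surjective a t w : a \notin t -> w \in A -> shift_prod t w = 0 ->
  exists u, [/\ u \in A, shift_prod t u = 0 & D u - a *: u = w].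
Proof.
elim: t w => [|b t IHt] w.
  by rewrite shift_prod_nil => _ wA ->; exists 0; rewrite mem0v !linear0 addr0.
rewrite inE negb_or => /andP[ab at_] wA; rewrite shift_prod_consr => tw.
have [|u [uA tu ue]] := IHt _ at_ _ tw; first by rewrite memvB ?memvZ ?DA.
exists ((a - b)^-1 *: (u - w)).
have ab0 : a - b != 0 by rewrite subr_eq0.
split; first by rewrite memvZ ?memvB.
  have ut : shift_prod (b :: t) u = 0.
    by rewrite shift_prod_cons tu linear0 scaler0 subrr.
  have wt : shift_prod (b :: t) w = 0 by rewrite shift_prod_consr.
  by apply/eqP; rewrite -memv_ker memvZ // memvB // memv_ker ?ut ?wt.
have e : D (u - w) - a *: (u - w) = (a - b) *: w.
  rewrite linearB /= scalerBr opprB [LHS](AC (2*2) ((1*4)*(2*3)))/= ue.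
  by rewrite [LHS](AC (2*2) ((1*3)*(4*2)))/= subrr add0r -scalerBl.
by rewrite linearZ /= scalerA mulrC -scalerA -scalerBr e scalerK.
Qed.

(** Primary decomposition relative to a bipartition of the roots, by induction
    on the number of factors: when a factor D - a is added, only the component
    belonging to the other class of roots has to be corrected, and there D - a
    is invertible. *)
Lemma root_decomposition (P : pred k) s w : w \in A -> shift_prod s w = 0 ->
  exists w1 w2, [/\ w1 \in A, w2 \in A, w = w1 + w2,
    shift_prod [seq a <- s | P a] w1 = 0
    & shift_prod [seq a <- s | ~~ P a] w2 = 0].
Proof.
elim: s w => [|a s IHs] w wA.
  by rewrite shift_prod_nil => ->; exists 0, 0; rewrite mem0v addr0 linear0.
rewrite shift_prod_consr => /IHs [|w1 [w2 [w1A w2A we k1 k2]]].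
  by rewrite memvB ?memvZ ?DA.
have shiftB u : D (w - u) - a *: (w - u) = w1 + w2 - (D u - a *: u).
  by rewrite -we linearB /= scalerBr !opprB [LHS](AC (2*2) ((1*4)*(3*2))).
case Pa: (P a); rewrite /= Pa /=.
  have [|u [uA tu ue]] := @shift_surjective a _ w2 _ w2A k2.
    by rewrite mem_filter Pa.
  exists (w - u), u; rewrite memvB // subrK; split=> //.
  by rewrite shift_prod_consr shiftB ue addrK.
have [|u [uA tu ue]] := @shift_surjective a _ w1 _ w1A k1.
  by rewrite mem_filter Pa.
exists u, (w - u); rewrite memvB // addrC subrK; split=> //.
by rewrite shift_prod_consr shiftB ue addrAC subrr add0r.
Qed.

Lemma exists_eigenvector t w : w \in A -> w != 0 -> shift_prod t w = 0 ->
  exists a u, [/\ a \in t, u \in A, u != 0 & D u = a *: u].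
Proof.
elim: t w => [|a t IHt] w wA w0.
  by rewrite shift_prod_nil => /eqP/negPn; rewrite w0.
rewrite shift_prod_consr => tw.
have [/subr0_eq Dw|n0] := eqVneq (D w - a *: w) 0.
  by exists a, w; rewrite mem_head.
have [|b [u [bt uA u0 Du]]] := IHt _ _ n0 tw; first by rewrite memvB ?memvZ ?DA.
by exists b, u; rewrite inE bt orbT.
Qed.

End Stable.
End RootOperators.

Section Roots.
Import VectorInternalTheory.
Variables (k : closedFieldType) (V : vectType k).

(** The Cayley-Hamilton theorem with the characteristic polynomial split into
    linear factors. *)
Lemma matrix_roots n (M : 'M[k]_n) : exists s : seq k, forall u : 'rV_n,
  foldr (fun a v => v *m M - a *: v) u s = 0.
Proof.
case: n M => [|n] M; first by exists [::] => u; apply: thinmx0.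
have [s ps] := closed_field_poly_normal (char_poly M).
have {}ps : char_poly M = \prod_(z <- s) ('X - z%:P).
  by rewrite ps (monicP (char_poly_monic M)) scale1r.
exists s => u; rewrite -[RHS](mulmx0 _ u) -(Cayley_Hamilton M) ps {ps}.
elim: s => [|a s IHs] /=; first by rewrite big_nil rmorph1 mulmx1.
rewrite IHs big_cons mulrC rmorphM /= rmorphB /= horner_mx_X horner_mx_C.
by rewrite [in RHS]mulmxA mulmxBr mul_mx_scalar.
Qed.

Lemma annihilating_roots (D : 'End(V)) :
  exists s, forall w, shift_prod D s w = 0.
Proof.
have [s sM] := matrix_roots (f2mx D); exists s => w.
apply: v2r_inj; rewrite linear0 -(sM (v2r w)) {sM}.
elim: s => [|a s IHs]; first by rewrite shift_prod_nil.
rewrite shift_prod_cons linearB linearZ /= -IHs; congr (_ - _).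
by move: (shift_prod D s w) => z; rewrite unlock /= r2vK.
Qed.

End Roots.

(** * Additive weights on a finite set of scalars *)

Section AdditiveWeights.
Variables (k : fieldType) (hk : [pchar k]%R =i pred0).

Lemma intr_eq0_pchar0 (z : int) : (z%:~R == 0 :> k) = (z == 0).
Proof.
have /pcharf0P nat0 := hk.
case: (intP z) => [|n|n]; first by rewrite !eqxx.
  by rewrite -pmulrn nat0.
by rewrite mulrNz !oppr_eq0 -pmulrn nat0.
Qed.

(** The relations b + c = d between members of s form a homogeneous linear
    system E with integer coefficients. The scalars s themselves solve it in k,
    with a nonzero value at a. Write E = L D R in Smith normal form: a solution
    in k is supported, in the coordinates given by L, on the zero rows of D,
    which in characteristic zero are the same over k and over the integers.
    Hence some row of the inverse of L is an integral solution with a nonzero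
    value at a. *)
Lemma additive_weight (s : seq k) a : a \in s -> a != 0 ->
  exists f : k -> int,
    0 < f a /\ {in s &, forall b c : k, b + c \in s -> f (b + c) = f b + f c}.
Proof.
move=> as_ a0; set n := size s.
pose T : finType := ('I_n * 'I_n * 'I_n)%type.
pose rel_ok (p : T) := s`_p.1.1 + s`_p.1.2 == s`_p.2.
pose E : 'M[int]_(n, #|T|) := \matrix_(i, c) let p := enum_val c in
  if rel_ok p then (i == p.1.1)%:R + (i == p.1.2)%:R - (i == p.2)%:R else 0.
have mulE (R : comNzRingType) (x : 'rV[R]_n) c : (x *m map_mx intr E) 0 c =
    let p := enum_val c in if rel_ok p then x 0 p.1.1 + x 0 p.1.2 - x 0 p.2 else 0.
  rewrite mxE /=; case ok: (rel_ok _); last first.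
    by rewrite big1 // => i _; rewrite !mxE /= ok mulr0.
  have sum1 j : \sum_i x 0 i * (i == j)%:R = x 0 j.
    rewrite (bigD1 j) //= eqxx mulr1 big1 ?addr0 // => i /negPf ->.
    by rewrite mulr0.
  rewrite -!sum1 -big_split -sumrB; apply: eq_bigr => i _.
  by rewrite !mxE /= ok rmorphB rmorphD /= !rmorph_nat mulrBr mulrDr.
have [L uL [R uR [d _ defE]]] := int_Smith_normal_form E.
set Dg := \matrix_(i, j) _ in defE.
pose x : 'rV[k]_n := \row_i s`_i.
pose mp m1 m2 (M : 'M[int]_(m1, m2)) := map_mx (intr : int -> k) M.
have xE : x *m mp _ _ E = 0.
  apply/rowP=> c; rewrite mulE [RHS]mxE /=; case: ifP => // /eqP e.
  by rewrite !mxE e subrr.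
pose y := x *m mp _ _ L.
have yD : y *m mp _ _ Dg = 0.
  have: y *m mp _ _ Dg *m mp _ _ R = 0.
    by rewrite /y -!mulmxA /mp -!map_mxM mulmxA -defE.
  move/(congr1 (mulmx^~ (mp _ _ (invmx R)))).
  by rewrite mul0mx -mulmxA /mp -map_mxM mulmxV // map_mx1 mulmx1.
have xy : x = y *m mp _ _ (invmx L).
  by rewrite -mulmxA /mp -map_mxM mulmxV // map_mx1 mulmx1.
clearbody y.
have ia : (index a s < n)%N by rewrite index_mem.
pose t0 := Ordinal ia.
have xa : x 0 t0 = a by rewrite mxE nth_index.
have [i [yi Li]] : exists i, y 0 i != 0 /\ invmx L i t0 != 0.
  have : (y *m mp _ _ (invmx L)) 0 t0 != 0 by rewrite -xy xa.
  rewrite mxE => /eqP; case: (pickP (fun i => (y 0 i != 0) && (invmx L i t0 != 0))).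
    by move=> i /andP[yi Li] _; exists i.
  move=> none []; rewrite big1 // => i _; have:= none i.
  rewrite [map_mx _ _ _ _]mxE; case: eqP => [->|_] /=; first by rewrite mul0r.
  by case: eqP => [->|//] _; rewrite mulr0.
have Di : row i Dg = 0.
  apply/rowP=> j; rewrite !mxE; case: eqP => // ij.
  move/rowP/(_ j): yD; rewrite !mxE (bigD1 i) //= big1 ?addr0 => [|i' ni].
    rewrite !mxE ij eqxx => /eqP; rewrite mulf_eq0 (negPf yi) /=.
    by rewrite intr_eq0_pchar0 -ij => /eqP.
  rewrite !mxE; case: eqP => [i'j|]; rewrite ?mulr0 //.
  by move: ni; rewrite -(inj_eq val_inj) /= i'j ij eqxx.
pose f := row i (invmx L).
have fE : f *m E = 0.
  by rewrite defE !mulmxA -row_mul mulVmx // row1 -rowE Di mul0mx.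
have ft : f 0 t0 != 0 by rewrite mxE.
pose F (b : k) : int := if insub (index b s) is Some j then f 0 j else 0.
have FE (j : 'I_n) b : b \in s -> index b s = j -> F b = f 0 j.
  by move=> bs e; rewrite /F e valK.
have Fa : F a = f 0 t0 by apply: FE.
(* Multiplying by F a makes the value at a positive. *)
exists (fun b : k => F a * F b); split.
  by rewrite -expr2 exprn_even_gt0 //= Fa.
move=> b c bs cs /= bcs; rewrite -mulrDr; congr (_ * _).
have ib : (index b s < n)%N by rewrite index_mem.
have ic : (index c s < n)%N by rewrite index_mem.
have ibc : (index (b + c)%R s < n)%N by rewrite index_mem.
rewrite (FE (Ordinal ib) b) // (FE (Ordinal ic) c) // (FE (Ordinal ibc) (b + c)) //.
pose p : T := (Ordinal ib, Ordinal ic, Ordinal ibc).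
have mid : map_mx intr E = E by apply/matrixP=> ? ?; rewrite mxE intz.
have := mulE int f (enum_rank p); rewrite mid fE mxE /= enum_rankK.
rewrite /rel_ok /= !nth_index // eqxx => /esym/subr0_eq.
by move=> ->.
Qed.

End AdditiveWeights.

(** * Complementary subalgebras: adjoint roots *)

Section Subalgebras.
Variables (k : fieldType) (V : vectType k) (g : V -> V -> V).
Hypothesis hg : lie_bracket g.
Implicit Types (A H K S T U W : {vspace V}) (x y z u v w : V).

Definition ad x : 'End(V) :=
  linfun (HB.pack (g x) (GRing.isLinear.Build k V V _ _ (lie_linear hg x))
          : {linear V -> V}).

Lemma adE x y : ad x y = g x y.
Proof. by rewrite lfunE. Qed.

(** Generalised eigenspaces for a and b bracket into the one for a + b. The
    Leibniz rule gives (D - a - b) [u, v] = [(D - a) u, v] + [u, (D - b) v] for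
    D = ad x, and each term has one factor fewer to go. *)
Lemma shift_prod_bracket x s t u v :
    shift_prod (ad x) s u = 0 -> shift_prod (ad x) t v = 0 ->
  exists r, shift_prod (ad x) r (g u v) = 0 /\
    {in r, forall c, exists a b, [/\ a \in s, b \in t & c = a + b]}.
Proof.
have [n] := ubnP (size s + size t); elim: n s t u v => // n IHn s t u v.
case: s => [|a s]; first by rewrite shift_prod_nil => _ -> _; exists [::];
  rewrite shift_prod_nil lie0l.
case: t => [|b t]; first by rewrite shift_prod_nil => _ _ ->; exists [::];
  rewrite shift_prod_nil lie0r.
move=> /= szn su tv.
have [|||r1 [r1k r1s]] := IHn s (b :: t) (ad x u - a *: u) v.
- by move: szn; rewrite /=; lia.
- by rewrite -shift_prod_consr.
- exact: tv.
have [|||r2 [r2k r2s]] := IHn (a :: s) t u (ad x v - b *: v).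
- by move: szn; rewrite /=; lia.
- exact: su.
- by rewrite -shift_prod_consr.
exists (a + b :: r1 ++ r2); split; last first.
  move=> c; rewrite inE mem_cat => /or3P[/eqP ->|/r1s|/r2s].
  - by exists a, b; rewrite !mem_head.
  - by case=> a' [b' [sa' ? ->]]; exists a', b'; rewrite inE sa' orbT.
  - by case=> a' [b' [? tb' ->]]; exists a', b'; rewrite [b' \in _]inE tb' orbT.
have -> : shift_prod (ad x) (a + b :: r1 ++ r2) (g u v) =
    shift_prod (ad x) (r1 ++ r2) (g (ad x u - a *: u) v) +
    shift_prod (ad x) (r1 ++ r2) (g u (ad x v - b *: v)).
  rewrite shift_prod_consr -linearD; congr (shift_prod _ _ _).
  rewrite !adE (lieBl hg) (lieBr hg) (lieZl hg) (lieZr hg) (lie_leibniz hg).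
  by rewrite scalerDl opprD addrACA.
by rewrite shift_prod_catr r1k linear0 shift_prod_cat r2k linear0 addr0.
Qed.

(** The bracket of two elements is killed by factors D - (a + b) with P a and
    P b, which are disjoint from the factors D - c with c in s and not P c. So
    its component for the latter roots vanishes. *)
Lemma root_subalgebra A x s (P : pred k) : subalgebra g A -> x \in A ->
    (forall w, shift_prod (ad x) s w = 0) ->
    {in s &, forall a b, P a -> P b -> a + b \in s -> P (a + b)} ->
  subalgebra g (A :&: lker (shift_prod (ad x) [seq a <- s | P a])).
Proof.
move=> sA xA ks Padd u v; rewrite !memv_cap !memv_ker.
move=> /andP[uA /eqP uk] /andP[vA /eqP vk]; have wA := sA _ _ uA vA.
have DA w : w \in A -> ad x w \in A by rewrite adE; apply: sA.
rewrite wA /=.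
have [w1 [w2 [w1A w2A we k1 k2]]] := root_decomposition DA P wA (ks _).
have [r [rk rP]] := shift_prod_bracket uk vk.
have w20 : w2 = 0.
  apply: (@shift_prod_disjoint _ _ (ad x) (r ++ [seq a <- s | P a])) k2.
    move=> c; rewrite mem_cat mem_filter; case/orP; last first.
      by case/andP=> Pc _; rewrite mem_filter Pc.
    move=> /rP [a [b []]]; rewrite !mem_filter.
    move=> /andP[Pa as_] /andP[Pb bs] ->; apply/negP => /andP[nP abs].
    by case/negP: nP; apply: Padd.
  have -> : w2 = g u v - w1 by rewrite we addrC addKr.
  by rewrite linearB /= shift_prod_catr rk shift_prod_cat k1 !linear0 addr0.
by rewrite we w20 addr0 k1.
Qed.

Definition ad_nilpotent A x := forall w, w \in A -> exists n, iter n (g x) w = 0.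

Definition splits A := exists S T, [/\ (S + T = A)%VS, (S :&: T = 0)%VS,
  S != 0%VS, T != 0%VS & subalgebra g S /\ subalgebra g T].

(** * Complementary subalgebras: the nilpotent case *)

(** H has a nonzero invariant in W / U, that is in every nonzero subquotient of
    A as an H-module. *)
Definition engel_property A H := forall U W, (W <= A)%VS -> ~~ (W <= U)%VS ->
    (forall h u, h \in H -> u \in U -> g h u \in U) ->
    (forall h w, h \in H -> w \in W -> g h w \in W) ->
  exists w, [/\ w \in W, w \notin U & forall h, h \in H -> g h w \in U].

Lemma subalgebra_line e : subalgebra g <[e]>.
Proof.
by move=> x y /vlineP[a ->] /vlineP[b ->];
  rewrite (lieZl hg) (lieZr hg) (lie_xx hg) !scaler0 mem0v.
Qed.

Lemma normalized_subalgebra K x : subalgebra g K ->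
  (forall h, h \in K -> g h x \in K) -> subalgebra g (K + <[x]>).
Proof.
move=> sK nK y z /memv_addP[u uK [_ /vlineP[a ->] ->]].
move=> /memv_addP[v vK [_ /vlineP[b ->] ->]].
rewrite (lieDl hg) !(lieDr hg) !(lieZl hg) !(lieZr hg) (lie_xx hg) !scaler0 addr0.
apply: (subvP (addvSl K _)); rewrite !memvD ?sK ?memvZ ?nK //.
by rewrite (lieC hg) memvN nK.
Qed.

(** Starting from K = 0, an invariant of K in H / K is a vector normalising K
    by which K can be enlarged, until only one dimension is missing. *)
Lemma codim1_ideal A H :
    (forall K, subalgebra g K -> (K <= A)%VS -> (\dim K < \dim H)%N ->
       engel_property A K) ->
    subalgebra g H -> (H <= A)%VS -> H != 0%VS ->
  exists K x, [/\ subalgebra g K, (K + <[x]> = H)%VS, x \notin K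
    & forall h, h \in K -> g h x \in K].
Proof.
move=> IH sH HA H0.
suff grow n K : subalgebra g K -> (K <= H)%VS -> (\dim K < \dim H)%N ->
    (\dim H - \dim K <= n)%N ->
    exists K x, [/\ subalgebra g K, (K + <[x]> = H)%VS, x \notin K
      & forall h, h \in K -> g h x \in K].
  apply: (grow (\dim H) 0%VS); rewrite ?sub0v ?dimv0 ?subn0 ?lt0n ?dimv_eq0 //.
  by move=> x y; rewrite !memv0 => /eqP -> _; rewrite (lie0l hg).
elim: n K => [|n IHn] K sK KH dK dn; first by lia.
have KA := subv_trans KH HA.
have [||||x [xH xK nK]] := IH K sK KA dK K H => //.
- by apply: contraTN dK => /dimvS; rewrite -leqNgt.
- by move=> h w hK; apply: sH; apply: (subvP KH).
have sKx := normalized_subalgebra sK nK.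
have KxH : (K + <[x]> <= H)%VS by rewrite subv_add KH -memvE.
have dKx : (\dim K < \dim (K + <[x]>))%N.
  rewrite (ltn_leqif (dimv_leqif_sup (addvSl _ _))).
  by rewrite subv_add subvv /= -memvE.
have [e|ne] := eqVneq (K + <[x]>)%VS H; first by exists K, x.
have lt : (\dim (K + <[x]>) < \dim H)%N.
  by rewrite (ltn_leqif (dimv_leqif_eq KxH)).
by apply: IHn sKx KxH lt _; lia.
Qed.

(** With K an ideal of codimension one in H and x outside K, the invariants of
    K in W / U are stable under ad x, which is nilpotent; the last nonzero
    iterate of ad x on one of them is killed by H. *)
Lemma engel A : subalgebra g A -> (forall x, x \in A -> ad_nilpotent A x) ->
  forall H, subalgebra g H -> (H <= A)%VS -> engel_property A H.
Proof.
move=> sA nil H; have [n] := ubnP (\dim H); elim: n H => // n IHn H dH sH HA.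
move=> U W WA WU HU HW.
have [H0|H0] := eqVneq H 0%VS.
  have [w wW wU] := subvPn WU; exists w; split=> // h.
  by rewrite H0 memv0 => /eqP ->; rewrite (lie0l hg) mem0v.
have [|K [x [sK eH xK nK]]] := @codim1_ideal A H _ sH HA H0.
  by move=> K sK KA dK; apply: IHn => //; apply: leq_trans dK _.
have KH : (K <= H)%VS by rewrite -eH addvSl.
have xH : x \in H by rewrite memvE -eH addvSr.
have dK : (\dim K < \dim H)%N.
  rewrite (ltn_leqif (dimv_leqif_sup KH)) -eH subv_add subvv /=.
  by rewrite -memvE.
have [|||w0 [w0W w0U w0K]] := IHn K _ sK (subv_trans KH HA) U W WA WU.
- exact: leq_trans dK _.
- by move=> h u hK; apply: HU; apply: (subvP KH).
- by move=> h u hK; apply: HW; apply: (subvP KH).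
have [m] := nil x (subvP HA _ xH) w0 (subvP WA _ w0W).
move=> w0m; have : iter m (g x) w0 \in U by rewrite w0m mem0v.
elim: m w0 w0W w0U w0K {w0m} => [|m IHm] w wW wU wK; first by rewrite /= (negPf wU).
rewrite iterSr; have [xwU _|xwU] := boolP (g x w \in U).
  exists w; split=> // h; rewrite -eH => /memv_addP[h1 h1K [_ /vlineP[a ->] ->]].
  by rewrite (lieDl hg) (lieZl hg) memvD ?memvZ // wK.
move=> xmU; apply: IHm xmU => //; first exact: HW.
move=> h hK; rewrite (lie_leibniz hg) memvD ?wK ?nK //.
by apply: HU => //; apply: wK.
Qed.

(** By [engel], A has a subalgebra K of codimension one; the complementary
    line is a subalgebra, and K is nonzero since dim A > 1. *)
Lemma nilpotent_splits A : subalgebra g A -> (1 < \dim A)%N ->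
  (forall x, x \in A -> ad_nilpotent A x) -> splits A.
Proof.
move=> sA dA nil.
have A0 : A != 0%VS by rewrite -dimv_eq0; lia.
have [|K [x [sK eA xK nK]]] := @codim1_ideal A A _ sA (subvv A) A0.
  by move=> K sK KA _; apply: engel.
have Kx : (K :&: <[x]> = 0)%VS.
  apply/eqP; rewrite -subv0; apply/subvP => u; rewrite memv_cap.
  case/andP=> uK /vlineP[a ue]; rewrite ue memv0.
  have [->|a0] := eqVneq a 0; first by rewrite scale0r.
  by case/negP: xK; rewrite -(scalerK a0 x) -ue memvZ.
have x0 : x != 0 by apply: contraNneq xK => ->; rewrite mem0v.
exists K, <[x]>%VS; split=> //; last 2 first.
- by rewrite -dimv_eq0 dim_vline x0.
- by split=> //; apply: subalgebra_line.
by apply: contraTneq dA => K0; rewrite -eA K0 add0v dim_vline x0.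
Qed.

End Subalgebras.

(** * Complementary subalgebras: the graded case *)

Section Gradings.
Variables (k : closedFieldType) (V : vectType k) (g : V -> V -> V).
Hypothesis hg : lie_bracket g.
Hypothesis hk : [pchar k]%R =i pred0.
Implicit Types (A : {vspace V}) (x w : V).

(** A vector that no power of ad x kills has a nonzero component for the
    nonzero roots. *)
Lemma nonzero_eigenvector A x s : subalgebra g A -> x \in A -> ~ ad_nilpotent g A x ->
    (forall w, shift_prod (ad hg x) s w = 0) ->
  exists a w, [/\ a \in s, a != 0, w \in A, w != 0 & g x w = a *: w].
Proof.
move=> sA xA nnil ks.
have DA w : w \in A -> ad hg x w \in A by rewrite adE; apply: sA.
have [w nwA] := not_all_ex_not _ _ nnil.
have [wA nw] := imply_to_and _ _ nwA.
have [w1 [w2 [w1A w2A we k1 k2]]] := root_decomposition DA (pred1 0) wA (ks w).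
have [w20|w20] := eqVneq w2 0; last first.
  have [a [u [as_ uA u0 ue]]] := exists_eigenvector DA w2A w20 k2.
  move: as_; rewrite mem_filter => /andP[a0 as_].
  by exists a, u; rewrite -(adE hg).
case: nw; exists (size [seq a <- s | pred1 0 a]); rewrite we w20 addr0 -[RHS]k1.
elim: s {ks k1 k2} => [|a s IHs]; first by rewrite shift_prod_nil.
rewrite /=; case: eqP => //= ->.
by rewrite shift_prod_cons IHs scale0r subr0 adE.
Qed.

(** The sign of an additive weight on the roots of ad x cuts A into two
    subalgebras. Neither is zero: x is an eigenvector for the root 0, of weight
    0, and w one for a root of positive weight. *)
Lemma nonnilpotent_splits A x :
  subalgebra g A -> x \in A -> ~ ad_nilpotent g A x -> splits g A.
Proof.
move=> sA xA nnil.
have [s ks] := annihilating_roots (ad hg x).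
have [a [w [as_ a0 wA w0 we]]] := nonzero_eigenvector sA xA nnil ks.
have [f [fa fD]] := additive_weight hk as_ a0.
have DA u : u \in A -> ad hg x u \in A by rewrite adE; apply: sA.
have x0 : x != 0.
  apply/eqP => x0; apply: nnil => u _; exists 1%N.
  by rewrite /= x0 (lie0l hg).
have Dx : ad hg x x = 0 *: x by rewrite adE (lie_xx hg) scale0r.
have Dw : ad hg x w = a *: w by rewrite adE.
have zs : 0 \in s.
  have /eqP := ks x; rewrite (shift_prod_eigen_eq0 _ Dx) (negPf x0) orbF.
  by [].
have f0 : f 0 = 0.
  have := fD 0 0 zs zs; rewrite addr0 => /(_ zs) /eqP.
  by rewrite -subr_eq0 opprD addNKr oppr_eq0 => /eqP.
pose P b := f b <= 0.
exists (A :&: lker (shift_prod (ad hg x) [seq b <- s | P b]))%VS.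
exists (A :&: lker (shift_prod (ad hg x) [seq b <- s | ~~ P b]))%VS.
split.
- apply/eqP; rewrite eqEsubv subv_add !capvSl /=; apply/subvP => u uA.
  have [u1 [u2 [u1A u2A ue k1 k2]]] := root_decomposition DA P uA (ks u).
  by rewrite ue memv_add // memv_cap memv_ker ?u1A ?u2A ?k1 ?k2 /=.
- apply/eqP; rewrite -subv0; apply/subvP => u; rewrite !memv_cap !memv_ker memv0.
  move=> /andP[/andP[_ /eqP k1] /andP[_ /eqP k2]]; apply/eqP.
  apply: shift_prod_disjoint k1 k2 => b; rewrite !mem_filter => /andP[-> _].
  by [].
- apply: contraNneq x0 => e; rewrite -memv0 -e memv_cap xA memv_ker.
  by rewrite (shift_prod_eigen_eq0 _ Dx) mem_filter /P f0 lexx zs.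
- apply: contraNneq w0 => e; rewrite -memv0 -e memv_cap wA memv_ker.
  by rewrite (shift_prod_eigen_eq0 _ Dw) mem_filter /P -ltNge fa as_.
split; apply: root_subalgebra => // b c bs cs Pb Pc bcs; rewrite /P fD //.
  by rewrite -[0]addr0 lerD.
by rewrite -ltNge addr_gt0 // ltNge.
Qed.

Lemma subalgebra_splits A : subalgebra g A -> (1 < \dim A)%N -> splits g A.
Proof.
move=> sA dA; have [nil|] := classic (forall x, x \in A -> ad_nilpotent g A x).
  exact: nilpotent_splits.
move=> /not_all_ex_not [x nx]; have [xA nnil] := imply_to_and _ _ nx.
exact: nonnilpotent_splits nnil.
Qed.

End Gradings.

(** * Semidirect products with a line *)

Section LineActions.
Variables (k : fieldType) (V : vectType k).
Hypothesis dV : (1 < \dim {:V})%N.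
Implicit Types (g h : V -> V -> V) (A M S T U W : {vspace V}) (x y z u v w e : V).

(** One operator G acts, on the kernel of a, and a single operator commutes with
    itself: its iterates cancel in pairs in the Jacobi sum. *)
Lemma line_action_lie (a : 'Hom(V, k^o)) (G : V -> V) :
    linear G -> (forall x, a (G x) = 0) ->
  lie_bracket (fun x y => a x *: G y - a y *: G x).
Proof.
move=> linG aG.
have GZ b x : G (b *: x) = b *: G x.
  have G0 : G 0 = 0.
    by apply: (addIr (G 0)); rewrite -{1}[G 0]scale1r -linG scaler0 !add0r.
  by have := linG b x 0; rewrite G0 !addr0.
have GB x y : G (x - y) = G x - G y.
  by rewrite addrC -scaleN1r linG scaleN1r addrC.
apply: lie_bracketI => [x b y z|x y|x|x y z].
- have -> : a (b *: y + z) = b * a y + a z :> k by rewrite linearP.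
  by rewrite linG scalerDr scalerDl scalerBr opprD addrACA !scalerA [b * a x]mulrC.
- by rewrite opprB.
- by rewrite subrr.
have E u v w : a u *: G (a v *: G w - a w *: G v) -
    a (a v *: G w - a w *: G v) *: G u =
    (a u * a v) *: G (G w) - (a u * a w) *: G (G v).
  rewrite linearB /= !functionalZ !aG !mulr0 subrr scale0r subr0.
  by rewrite GB !GZ scalerBr !scalerA.
rewrite !E [a z * a x]mulrC [a z * a y]mulrC [a y * a x]mulrC.
rewrite [LHS](AC ((2*2)*2) ((1*4)*(2*5)*(3*6)))/= !subrr addNr.
by rewrite !addr0.
Qed.

(** All partial sums are Lie brackets, by [line_action_lie], since they share
    the functional a. *)
Lemma wedge_sum_assemblable (I : Type) (r : seq I) (a : 'Hom(V, k^o))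
    (f : I -> 'Hom(V, k^o)) (v : I -> V) :
    (forall i, a (v i) = 0) ->
  assemblable (fun x y => \sum_(i <- r) wedge_bracket a (f i) (v i) x y).
Proof.
move=> av; elim: r => [|i r IHr].
  by apply: zero_assemblable => // x y; rewrite big_nil.
have dec x y : \sum_(j <- i :: r) wedge_bracket a (f j) (v j) x y =
    wedge_bracket a (f i) (v i) x y + \sum_(j <- r) wedge_bracket a (f j) (v j) x y.
  by rewrite big_cons.
apply: assemblableD dec _ IHr; last exact: wedge_assemblable.
pose G x := \sum_(j <- i :: r) f j x *: v j.
have linG : linear G.
  move=> b x y; rewrite /G scaler_sumr -big_split; apply: eq_bigr => j _ /=.
  by rewrite linearP scalerDl scalerA.
apply: eq_lie_bracket (line_action_lie linG _) => [x y|x].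
  rewrite /G !scaler_sumr -sumrB; apply: eq_bigr => j _.
  by rewrite !scalerA -scalerBl.
by rewrite linear_sum big1 // => j _; rewrite /= functionalZ av mulr0.
Qed.

(** The vector e may be zero, in which case g = 0. The operator of e on M is
    cut into rank-one operators along a basis of M. *)
Lemma line_action_assemblable e M g : lie_bracket g ->
    (<[e]> :&: M = 0)%VS -> (<[e]> + M = fullv)%VS ->
    (forall m, m \in M -> g e m \in M) ->
    (forall m m', m \in M -> m' \in M -> g m m' = 0) ->
  assemblable g.
Proof.
move=> hg eM0 eMf geM gMM.
pose p := daddv_pi <[e]> M; pose q := daddv_pi M <[e]>.
have pq x : p x + q x = x by rewrite daddv_pi_add // eMf memvf.
have qM x : q x \in M by apply: memv_pi.
pose a := (coordinate [tuple e] 0 \o p)%VF.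
have pE x : p x = a x *: e.
  have : p x \in <<[tuple e]>>%VS by rewrite span_seq1 memv_pi.
  by move/coord_span; rewrite big_ord1 /a comp_lfunE coordinateE.
pose G := (ad hg e \o q)%VF.
have GE x : G x = g e (q x) by rewrite comp_lfunE adE.
have GM x : G x \in M by rewrite GE geM.
have aM m : m \in M -> a m = 0.
  move=> mM; have pm : p m = 0.
    by apply: (addIr (q m)); rewrite pq add0r daddv_pi_id // capvC.
  by rewrite /a comp_lfunE pm linear0.
have gE x y : g x y = a x *: G y - a y *: G x.
  rewrite -{1}(pq x) -{1}(pq y) !pE (lieDl hg) !(lieDr hg) (gMM (q x) (q y)) // addr0.
  rewrite !(lieZl hg) !(lieZr hg) (lie_xx hg) !scaler0 add0r !GE.
  by rewrite (lieC hg (q x)) scalerN.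
pose X := vbasis M.
have XM (i : 'I_(\dim M)) : X`_i \in M.
  by apply: vbasis_mem; apply: mem_nth; rewrite size_tuple.
pose f i := (coordinate X i \o G)%VF.
have GX x : G x = \sum_i f i x *: X`_i.
  rewrite {1}(coord_vbasis (GM x)); apply: eq_bigr => i _.
  by rewrite [f i x]comp_lfunE coordinateE.
apply: eq_assemblable
  (@wedge_sum_assemblable _ (index_enum _) a f (fun i => X`_i) _); last first.
  by move=> i; apply: aM.
move=> x y; rewrite gE !GX !scaler_sumr -sumrB; apply: eq_bigr => i _.
by rewrite !scalerA -scalerBl.
Qed.

End LineActions.

(** * Induction on semidirect products *)

Section Induction.
Variables (k : closedFieldType) (V : vectType k).
Hypotheses (hk : [pchar k]%R =i pred0) (dV : (1 < \dim {:V})%N).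
Implicit Types (g : V -> V -> V) (A M S T : {vspace V}).

(** The brackets treated here are those of A |x M with M an abelian ideal; the
    class is stable under contraction along S + M and along T, whatever the
    splitting A = S + T, and the first factor gets smaller. *)
Lemma semidirect_assemblable n g A M :
    (\dim A <= n)%N -> lie_bracket g ->
    (A :&: M = 0)%VS -> (A + M = fullv)%VS -> subalgebra g A ->
    (forall a m, a \in A -> m \in M -> g a m \in M) ->
    (forall m m', m \in M -> m' \in M -> g m m' = 0) ->
  assemblable g.
Proof.
elim: n g A M => [|n IHn] g A M dA hg AM0 AMf sA gAM gMM.
  have A0 : A = 0%VS by apply/eqP; rewrite -dimv_eq0 -leqn0.
  rewrite {}A0 in AM0 AMf; apply: (@line_action_assemblable _ _ dV 0 M) => //.
  by move=> m _; rewrite (lie0l hg) mem0v.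
have [dA2|dA1] := ltnP 1 (\dim A); last first.
  have [e eA] : exists e, A = <[e]>%VS.
    exists (vpick A); apply/eqP; rewrite eq_sym eqEdim -memvE memv_pick /=.
    by rewrite dim_vline vpick0 -dimv_eq0; case: (\dim A) dA1 => [|[]].
  apply: (@line_action_assemblable _ _ dV e M) => //; rewrite -?eA //.
  by move=> m mM; apply: gAM; rewrite ?eA ?memv_line.
have [S [T [eA ST0 S0 T0 [sS sT]]]] := subalgebra_splits hg hk sA dA2.
have dST : (\dim S + \dim T = \dim A)%N by rewrite -eA dimv_disjoint_sum.
have SA : (S <= A)%VS by rewrite -eA addvSl.
have TA : (T <= A)%VS by rewrite -eA addvSr.
have dS : (\dim S <= n)%N by move: T0; rewrite -dimv_eq0; lia.
have dT : (\dim T <= n)%N by move: S0; rewrite -dimv_eq0; lia.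
have SMT0 : ((S + M) :&: T = 0)%VS.
  apply/eqP; rewrite -subv0; apply/subvP => t; rewrite memv_cap memv0.
  case/andP => /memv_addP[u uS [m mM te]] tT.
  have m0 : m = 0.
    apply/eqP; rewrite -memv0 -AM0 memv_cap mM andbT.
    have -> : m = t - u by rewrite te addrAC subrr add0r.
    by apply: memvB; [apply: (subvP TA) | apply: (subvP SA)].
  by rewrite -memv0 -ST0 memv_cap tT te m0 addr0 uS.
have SMTf : ((S + M) + T = fullv)%VS.
  by rewrite -addvA [(M + T)%VS]addvC addvA eA.
have gSM u m : u \in S -> m \in M -> g u m \in M.
  by move=> uS; apply: gAM; apply: (subvP SA).
have sSM : subalgebra g (S + M).
  move=> _ _ /memv_addP[u uS [m mM ->]] /memv_addP[v vS [m' mM' ->]].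
  rewrite (lieDl hg) !(lieDr hg) (gMM m m') // addr0 -addrA memv_add ?sS //.
  by apply: memvD; [|rewrite (lieC hg) memvN]; apply: gSM.
have SSM u : u \in S -> u \in (S + M)%VS by move=> uS; apply: (subvP (addvSl S M)).
have MSM u : u \in M -> u \in (S + M)%VS by move=> uM; apply: (subvP (addvSr S M)).
have hc := contraction_lie hg SMT0 SMTf sSM.
have TSM0 : (T :&: (S + M) = 0)%VS by rewrite capvC.
have TSMf : (T + (S + M) = fullv)%VS by rewrite addvC.
apply: (assemblableD hg (contractionD hg SMT0 SMTf)).
  apply: (IHn _ S (T + M)%VS dS).
  - exact: contraction_lie.
  - apply/eqP; rewrite -subv0; apply/subvP => u; rewrite memv_cap memv0.
    case/andP => uS /memv_addP[t tT [m mM ue]].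
    have m0 : m = 0.
      apply/eqP; rewrite -memv0 -AM0 memv_cap mM andbT.
      have -> : m = u - t by rewrite ue addrAC subrr add0r.
      by apply: memvB; [apply: (subvP SA) | apply: (subvP TA)].
    by rewrite -memv0 -ST0 memv_cap uS ue m0 addr0 tT.
  - by rewrite addvA eA.
  - by move=> u v uS vS; rewrite contraction_in ?SSM // sS.
  - move=> u w uS /memv_addP[t tT [m mM ->]].
    rewrite (lieDr hc) (contraction_mixed hg SMT0 SMTf (SSM u uS) tT).
    rewrite (contraction_in hg SMT0 SMTf (SSM u uS) (MSM m mM)).
    by rewrite memv_add ?memv_pi ?gSM.
  - move=> _ _ /memv_addP[t tT [m mM ->]] /memv_addP[t' tT' [m' mM' ->]].
    have mixed0 u w : u \in M -> w \in T -> contraction g (S + M) T u w = 0.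
      move=> uM wT; rewrite contraction_mixed ?MSM //; apply: (daddv_pi0 TSM0).
      by apply: MSM; rewrite (lieC hg) memvN gAM //; apply: (subvP TA).
    rewrite (lieDl hc) !(lieDr hc) (contraction_out hg SMT0 SMTf tT tT').
    rewrite (lieC hc t m') (mixed0 m' t) // (mixed0 m t') //.
    rewrite (contraction_in hg SMT0 SMTf (MSM m mM) (MSM m' mM')) gMM //.
    by rewrite oppr0 !addr0.
apply: (IHn _ T (S + M)%VS dT) => //.
- exact: contraction_lie.
- by move=> u v uT vT; rewrite contraction_in // sT.
- by move=> u v uT vT; rewrite contraction_mixed // memv_pi.
by move=> u v uT vT; rewrite contraction_out.
Qed.

End Induction.

Theorem theorem5p1 (k : closedFieldType) (hk : [pchar k]%R =i pred0)
    (V : vectType k) (g : V -> V -> V) (hg : lie_bracket g) :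
  completely_disassemblable g.
Proof.
have [dV|dV] := leqP (\dim {:V}) 1.
  left; split=> // x y.
  have [e eV] : exists e, {:V}%VS = <[e]>%VS.
    exists (vpick {:V}); apply/eqP; rewrite eq_sym eqEdim subvf /=.
    by rewrite dim_vline vpick0 -dimv_eq0; case: (\dim {:V}) dV => [|[]].
  have /vlineP[a ->] : x \in <[e]>%VS by rewrite -eV memvf.
  have /vlineP[b ->] : y \in <[e]>%VS by rewrite -eV memvf.
  by rewrite (lieZl hg) (lieZr hg) (lie_xx hg) !scaler0.
right; apply: (@semidirect_assemblable k V hk dV (\dim {:V}) g fullv 0) => //.
- by rewrite capv0.
- by rewrite addv0.
- by move=> x y _ _; rewrite memvf.
- by move=> a m _; rewrite !memv0 => /eqP ->; rewrite (lie0r hg).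
by move=> m m'; rewrite !memv0 => /eqP -> _; rewrite (lie0l hg).
Qed.
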